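(* Let $M,H$ be $3$-Lie algebras over a field $\mathbb F$ with $\operatorname{char}\mathbb F\ne2$, let $A=M\dot+H$ be a $(\mu,\rho,\beta)$-extension of $H$ by $M$ which is a $3$-Lie algebra, and let $(\sigma,\tau)\in\operatorname{Der}(M)\times\operatorname{Der}(H)$. Then the pair $(\sigma,\tau)$ is extendable if and only if there exists a linear map $\gamma:M\to H$ satisfying, for all $x,x_1,x_2,x_3\in M$ and $h\in H$, $$\tau\mu(x_1,x_2,x_3)+\gamma[x_1,x_2,x_3]=\mu(\sigma x_1,x_2,x_3)+\mu(x_1,\sigma x_2,x_3)+\mu(x_1,x_2,\sigma x_3)+\rho(x_1,x_2)\gamma(x_3)+\rho(x_3,x_1)\gamma(x_2)+\rho(x_2,x_3)\gamma(x_1),$$ $$[\tau,\rho(x_1,x_2)]=\rho(\sigma x_1,x_2)+\rho(x_1,\sigma x_2)+\beta(\gamma(x_1),x_2)+\beta(x_1,\gamma(x_2)),$$ $$[\tau,\beta(x,h)]=\beta(\sigma x,h)+\beta(x,\tau h)+\operatorname{ad}(\gamma(x),h).$$ The extension $\delta\in\operatorname{Der}(A)$ is given by the formula $\delta(x+h)=\sigma x+\gamma(x)+\tau(h)$ for all $x\in M$, $h\in H$.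
   Context: A $3$-Lie algebra is a vector space with a trilinear skew-symmetric bracket satisfying $[[x,y,z],u,v]=[[x,u,v],y,z]+[x,[y,u,v],z]+[x,y,[z,u,v]]$. A derivation is a linear map $d$ with $d[x,y,z]=[dx,y,z]+[x,dy,z]+[x,y,dz]$; $\operatorname{Der}$ denotes the space of derivations. Brackets of $M$ and $H$ are written $[\,,,]$; $\operatorname{ad}(a,b)c=[a,b,c]$ for $a,b,c\in H$; for linear maps $f,g$ of $H$, $[f,g]=fg-gf$. $(\mu,\rho,\beta)$-extension: let $A=M\dot+H$ be the direct sum of vector spaces. Let $\rho:M\wedge M\to\operatorname{Der}(H)$ (skew-symmetric bilinear), $\beta:M\wedge H\to\operatorname{Der}(H)$ (bilinear in $(x,h)\in M\times H$, with the convention $\beta(h,x)=-\beta(x,h)$) and $\mu:M\wedge M\wedge M\to H$ (skew-symmetric trilinear) be linear maps. The $(\mu,\rho,\beta)$-extension of $H$ by $M$ is $A$ with the skew-symmetric trilinear bracket determined by $[x,y,z]_A=[x,y,z]_M+\mu(x,y,z)$, $[x,y,h]_A=\rho(x,y)h$, $[x,h_1,h_2]_A=\beta(x,h_1)h_2$, $[h_1,h_2,h_3]_A=[h_1,h_2,h_3]_H$ for $x,y,z\in M$, $h,h_i\in H$ (so in particular $\beta(x,h_1)h_2=-\beta(x,h_2)h_1$). Let $i:H\to A$, $i(h)=h$, and $p:A\to M$, $p(x+h)=x$. The pair $(\sigma,\tau)$ is extendable (extends to $\delta\in\operatorname{Der}(A)$) if there is $\delta\in\operatorname{Der}(A)$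 with $\delta\circ i=i\circ\tau$ and $p\circ\delta=\sigma\circ p$. *)

(* Defs.v *)
From HB Require Import structures.
From mathcomp Require Import all_boot all_order all_algebra.
Set Implicit Arguments.
Unset Strict Implicit.
Unset Printing Implicit Defensive.
Import GRing.Theory.
Local Open Scope ring_scope.

Section MultilinearMaps.
Variables (F : fieldType) (U V W X : lmodType F).

Definition bilinear2 (f : U -> V -> W) : Prop :=
  (forall y, linear (fun x => f x y)) /\ (forall x, linear (f x)).

Definition trilinear (f : U -> V -> W -> X) : Prop :=
  [/\ forall y z, linear (fun x => f x y z),
      forall x z, linear (fun y => f x y z)
    & forall x y, linear (f x y)].

Definition skew2 (f : U -> U -> V) : Prop := forall x y, f y x = - f x y.

(* The two adjacent transpositions generate the symmetric group on three
   letters. *)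
Definition skew3 (f : U -> U -> U -> V) : Prop :=
  (forall x y z, f y x z = - f x y z) /\ (forall x y z, f x z y = - f x y z).

End MultilinearMaps.

Section ThreeLie.
Variables (F : fieldType) (V : lmodType F).

Record three_lie (br : V -> V -> V -> V) : Prop := ThreeLie {
  three_lie_trilinear : trilinear br;
  three_lie_skew : skew3 br;
  three_lie_jacobi : forall x y z u v,
    br (br x y z) u v =
      br (br x u v) y z + br x (br y u v) z + br x y (br z u v) }.

Definition derivation (br : V -> V -> V -> V) (d : V -> V) : Prop :=
  linear d /\
  forall x y z, d (br x y z) = br (d x) y z + br x (d y) z + br x y (d z).

Definition ad (br : V -> V -> V -> V) (a b : V) : V -> V := br a b.

Definition commutator (f g : V -> V) : V -> V := (f \o g) \- (g \o f).

End ThreeLie.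

Section Extension.
Variables (F : fieldType) (M H : lmodType F).

(* The direct sum of M and H is the product module (M * H)%type. *)
Definition inM (x : M) : M * H := (x, 0).
Definition inH (h : H) : M * H := (0, h).
Definition prM (a : M * H) : M := a.1.

Variables (brM : M -> M -> M -> M) (brH : H -> H -> H -> H).
Variables (mu : M -> M -> M -> H) (rho : M -> M -> H -> H)
          (beta : M -> H -> H -> H).

Record extension_data : Prop := ExtensionData {
  mu_trilinear : trilinear mu;
  mu_skew : skew3 mu;
  rho_bilinear : forall k, bilinear2 (fun x y => rho x y k);
  rho_skew : forall k, skew2 (fun x y => rho x y k);
  rho_derivation : forall x y, derivation brH (rho x y);
  beta_bilinear : forall k, bilinear2 (fun x h => beta x h k);
  beta_derivation : forall x h, derivation brH (beta x h) }.

(* A skew-symmetric trilinear bracket on M * H is determined by its values on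
   the four kinds of triples below; its existence forces
   beta x h k = - beta x k h. *)
Record extension_bracket (brA : M * H -> M * H -> M * H -> M * H) : Prop :=
  ExtensionBracket {
    extension_trilinear : trilinear brA;
    extension_skew : skew3 brA;
    extension_MMM : forall x y z,
      brA (inM x) (inM y) (inM z) = inM (brM x y z) + inH (mu x y z);
    extension_MMH : forall x y h,
      brA (inM x) (inM y) (inH h) = inH (rho x y h);
    extension_MHH : forall x h1 h2,
      brA (inM x) (inH h1) (inH h2) = inH (beta x h1 h2);
    extension_HHH : forall h1 h2 h3,
      brA (inH h1) (inH h2) (inH h3) = inH (brH h1 h2 h3) }.

(* beta on H x M, by the convention beta(h, x) = - beta(x, h). *)
Definition betaHM (h : H) (x : M) : H -> H := \- (beta x h).

Variables (sigma : M -> M) (tau : H -> H).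

Definition extends_to (brA : M * H -> M * H -> M * H -> M * H)
    (delta : M * H -> M * H) : Prop :=
  [/\ derivation brA delta,
      delta \o inH =1 inH \o tau
    & prM \o delta =1 sigma \o prM].

Definition extendable (brA : M * H -> M * H -> M * H -> M * H) : Prop :=
  exists delta, extends_to brA delta.

Record compatible (gamma : M -> H) : Prop := Compatible {
  compatible_mu : forall x1 x2 x3,
    tau (mu x1 x2 x3) + gamma (brM x1 x2 x3) =
      mu (sigma x1) x2 x3 + mu x1 (sigma x2) x3 + mu x1 x2 (sigma x3)
      + rho x1 x2 (gamma x3) + rho x3 x1 (gamma x2) + rho x2 x3 (gamma x1);
  compatible_rho : forall x1 x2,
    commutator tau (rho x1 x2) =1
      rho (sigma x1) x2 \+ rho x1 (sigma x2)
      \+ betaHM (gamma x1) x2 \+ beta x1 (gamma x2);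
  compatible_beta : forall x h,
    commutator tau (beta x h) =1
      beta (sigma x) h \+ beta x (tau h) \+ ad brH (gamma x) h }.

Definition glue (gamma : M -> H) (a : M * H) : M * H :=
  inM (sigma a.1) + inH (gamma a.1) + inH (tau a.2).

End Extension.

(* Main.v *)
From HB Require Import structures.
Require Import Defs.
From mathcomp Require Import all_boot all_order all_algebra.
Import GRing.Theory.
Local Open Scope ring_scope.
Set Implicit Arguments.
Unset Strict Implicit.
Unset Printing Implicit Defensive.

(** A linear map [delta] of [A] that is compatible with [inH] and [prM] is
    [glue sigma tau gamma] for [gamma x] the [H]-component of [delta (inM x)].
    Both sides of the Leibniz rule are skew-symmetric trilinear maps on [A], so
    the rule holds as soon as it holds on the triples of type MMM, MMH, MHH and
    HHH.  On the first three its [H]-components are the three compatibility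
    equations; all the rest follows from [sigma] and [tau] being derivations. *)

(** * Linear and skew-symmetric trilinear maps given as bare functions *)

Section Trilinear.
Variables (F : fieldType) (U V : lmodType F).

Lemma linear_add (f : U -> V) : linear f -> {morph f : x y / x + y}.
Proof. by move=> lf x y; have := lf 1 x y; rewrite !scale1r. Qed.

Lemma linear_zero (f : U -> V) : linear f -> f 0 = 0.
Proof.
by move=> lf; apply: (addIr (f 0)); rewrite -linear_add // !add0r.
Qed.

Lemma linear_opp (f : U -> V) : linear f -> {morph f : x / - x}.
Proof.
move=> lf x; apply: (addIr (f x)).
by rewrite -linear_add // !addNr linear_zero.
Qed.

Variable f : U -> U -> U -> V.

(** A cyclic rotation is a product of two adjacent transpositions, so the signs cancel. *)
Lemma skew3_rot : skew3 f -> forall x y z, f y z x = f x y z.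
Proof. by case=> s1 s2 x y z; rewrite s2 s1 opprK. Qed.

Lemma trilinear_addr : trilinear f ->
  forall a b, {morph f a b : c d / c + d}.
Proof. by case=> _ _ lf a b; apply: linear_add. Qed.

End Trilinear.

(** * The two sides of the Leibniz rule as skew-symmetric trilinear maps *)

Section Leibniz.
Variables (F : fieldType) (V : lmodType F).
Variables (br : V -> V -> V -> V) (d : V -> V).
Hypotheses (trilin_br : trilinear br) (skew_br : skew3 br) (lin_d : linear d).

Definition leibniz (x y z : V) : V :=
  br (d x) y z + br x (d y) z + br x y (d z).

Lemma comp_trilinear : trilinear (fun x y z => d (br x y z)).
Proof.
by case: trilin_br => l1 l2 l3; split=> a b c u v;
  rewrite ?l1 ?l2 ?l3 lin_d.
Qed.

Lemma comp_skew3 : skew3 (fun x y z => d (br x y z)).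
Proof.
by case: skew_br => s1 s2; split=> x y z; rewrite ?(s1 x y) ?(s2 x y z) linear_opp.
Qed.

Lemma leibniz_trilinear : trilinear leibniz.
Proof.
case: trilin_br => l1 l2 l3; split=> x y c u v;
  by rewrite /leibniz lin_d ?l1 ?l2 ?l3 !scalerDr [RHS]addrACA (addrACA (c *: _)).
Qed.

(** Swapping two adjacent arguments negates all three terms and exchanges the two in which [d] acts
    on a swapped argument. *)
Lemma leibniz_skew3 : skew3 leibniz.
Proof.
case: skew_br => s1 s2; split=> x y z; rewrite /leibniz.
  by rewrite (s1 (d x)) (s1 x (d y)) (s1 x y) !opprD (addrC (- br x _ _)).
by rewrite (s2 (d x)) (s2 x (d y)) (s2 x y) !opprD addrAC.
Qed.

End Leibniz.

(** Maps are compared pointwise only, so the property has to be carried along [=1]. *)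
Lemma eq_derivation (F : fieldType) (V : lmodType F)
    (br : V -> V -> V -> V) (d e : V -> V) :
  d =1 e -> derivation br d -> derivation br e.
Proof.
by move=> de [ld dd]; split=> [c|x] y z; rewrite -!de ?ld ?dd.
Qed.

(** * Skew-symmetric trilinear maps on a direct sum *)

Section DirectSum.
Variables (F : fieldType) (M H V : lmodType F).
Implicit Types (x y z : M) (h k : H) (a b c : M * H).

Lemma inM_inH_split a : a = inM H a.1 + inH M a.2.
Proof. by case: a => x h; congr (_, _); rewrite ?addr0 ?add0r. Qed.

Lemma pairE x h : inM H x + inH M h = (x, h).
Proof. by congr (_, _); rewrite ?addr0 ?add0r. Qed.

(** Splitting every argument leaves eight types of triples. Up to cyclic rotation, which changes no
    sign, they are MMM, MMH, MHH and HHH. *)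
Lemma eq_trilinear_skew3 (f g : M * H -> M * H -> M * H -> V) :
  trilinear f -> skew3 f -> trilinear g -> skew3 g ->
  (forall x y z, f (inM H x) (inM H y) (inM H z)
                 = g (inM H x) (inM H y) (inM H z)) ->
  (forall x y h, f (inM H x) (inM H y) (inH M h)
                 = g (inM H x) (inM H y) (inH M h)) ->
  (forall x h k, f (inM H x) (inH M h) (inH M k)
                 = g (inM H x) (inH M h) (inH M k)) ->
  (forall h k l, f (inH M h) (inH M k) (inH M l)
                 = g (inH M h) (inH M k) (inH M l)) ->
  forall a b c, f a b c = g a b c.
Proof.
move=> tf sf tg sg fgMMM fgMMH fgMHH fgHHH.
have split_last a b : (forall x, f a b (inM H x) = g a b (inM H x)) ->
    (forall h, f a b (inH M h) = g a b (inH M h)) -> f a b =1 g a b.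
  by move=> fgM fgH c; rewrite (inM_inH_split c) !trilinear_addr // fgM fgH.
have rot a b c : f c a b = g c a b -> f a b c = g a b c.
  by rewrite -(skew3_rot sf c a b) -(skew3_rot sg c a b).
have rot' a b c : f b c a = g b c a -> f a b c = g a b c.
  by move=> /rot /rot.
move=> a b c; apply/split_last => [z|l]; apply/rot; apply/split_last => [y|k];
  apply/rot; apply/split_last => [x|h] //.
- exact/rot'.
- exact/rot'.
- exact/rot.
- exact/rot.
Qed.

End DirectSum.

(** * The Leibniz rule for [glue] on the extension *)

Section Extension.
Variables (F : fieldType) (M H : lmodType F).
Variables (brM : M -> M -> M -> M) (brH : H -> H -> H -> H).
Variables (mu : M -> M -> M -> H) (rho : M -> M -> H -> H).
Variables (beta : M -> H -> H -> H).
Variable brA : M * H -> M * H -> M * H -> M * H.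
Hypothesis extA : extension_bracket brM brH mu rho beta brA.
Variables (sigma : M -> M) (tau : H -> H) (gamma : M -> H).
Hypotheses (der_sigma : derivation brM sigma) (der_tau : derivation brH tau)
  (lin_gamma : linear gamma).

Notation inM := (@inM F M H).
Notation inH := (@inH F M H).
Notation delta := (glue sigma tau gamma).

Let lin_sigma : linear sigma := der_sigma.1.
Let lin_tau : linear tau := der_tau.1.
Let tA := extension_trilinear extA.
Let sA := extension_skew extA.

Lemma inH_linear : linear inH.
Proof. by move=> c h k; congr (_, _); rewrite /= scaler0 addr0. Qed.

Lemma inH_inj : injective inH.
Proof. by move=> h k []. Qed.

Lemma extension_HMM h x y : brA (inH h) (inM x) (inM y) = inH (rho x y h).
Proof. by rewrite -(skew3_rot sA) (extension_MMH extA). Qed.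

Lemma extension_MHM x h y : brA (inM x) (inH h) (inM y) = inH (rho y x h).
Proof. by rewrite (skew3_rot sA) (extension_MMH extA). Qed.

(** A transposition is used rather than a rotation, so that [k] remains the vector acted upon; its
    sign is the one in [betaHM]. *)
Lemma extension_HMH h x k :
  brA (inH h) (inM x) (inH k) = inH (betaHM beta h x k).
Proof.
by rewrite (proj1 sA) (extension_MHH extA) /betaHM (linear_opp inH_linear).
Qed.

(** The type HHM is left out: [glue] maps H into H, so expanding the rule on the four standard types
    never produces it. *)
Definition extensionE :=
  (extension_MMM extA, extension_MMH extA, extension_MHH extA,
   extension_HHH extA, extension_HMM, extension_MHM, extension_HMH).

Lemma glueE a : delta a = (sigma a.1, gamma a.1 + tau a.2).
Proof. by rewrite /glue -addrA -(linear_add inH_linear) pairE. Qed.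

Lemma glue_inM x : delta (inM x) = inM (sigma x) + inH (gamma x).
Proof. by rewrite /glue /= (linear_zero lin_tau) addr0. Qed.

Lemma glue_inH h : delta (inH h) = inH (tau h).
Proof.
by rewrite /glue /= (linear_zero lin_sigma) (linear_zero lin_gamma) !add0r.
Qed.

Lemma glue_linear : linear delta.
Proof.
move=> c a b; rewrite !glueE /= lin_sigma lin_gamma lin_tau addrACA.
by rewrite -scalerDr.
Qed.

Lemma extension_add1 a a' b c : brA (a + a') b c = brA a b c + brA a' b c.
Proof. by case: tA => l1 _ _; apply: (linear_add (l1 b c)). Qed.

Lemma extension_add2 a b b' c : brA a (b + b') c = brA a b c + brA a b' c.
Proof. by case: tA => _ l2 _; apply: (linear_add (l2 a c)). Qed.

Lemma extension_add3 a b c c' : brA a b (c + c') = brA a b c + brA a b c'.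
Proof. by case: tA => _ _ l3; apply: (linear_add (l3 a b)). Qed.

Definition extensionD := (extension_add1, extension_add2, extension_add3).

Lemma leibniz_MMM x1 x2 x3 :
  delta (brA (inM x1) (inM x2) (inM x3))
    = leibniz brA delta (inM x1) (inM x2) (inM x3) <->
  tau (mu x1 x2 x3) + gamma (brM x1 x2 x3) =
    mu (sigma x1) x2 x3 + mu x1 (sigma x2) x3 + mu x1 x2 (sigma x3)
    + rho x1 x2 (gamma x3) + rho x3 x1 (gamma x2) + rho x2 x3 (gamma x1).
Proof.
rewrite /leibniz !glue_inM !extensionD !extensionE.
rewrite (linear_add glue_linear) glue_inM glue_inH der_sigma.2.
rewrite -!(addrA (inM _) (inH _) (inH _)) -!(linear_add inH_linear) !pairE.
(* The H-components come in pairs [mu], [rho], one pair for each differentiated argument; the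
   reordering puts the [mu] terms first. The M-components agree because [sigma] is a derivation. *)
rewrite (addrC (gamma _)) -[X in _ <-> _ = X](AC (2*2*2) (1*3*5*6*4*2)).
by split=> [/(congr1 snd) | ->].
Qed.

(** Both sides lie in H. Differentiating the last argument gives [rho x1 x2 (tau h)], and moving
    this term to the left produces the commutator. *)
Lemma leibniz_MMH x1 x2 h :
  delta (brA (inM x1) (inM x2) (inH h))
    = leibniz brA delta (inM x1) (inM x2) (inH h) <->
  commutator tau (rho x1 x2) h =
    rho (sigma x1) x2 h + rho x1 (sigma x2) h
    + betaHM beta (gamma x1) x2 h + beta x1 (gamma x2) h.
Proof.
rewrite /leibniz !glue_inM !glue_inH !extensionD !extensionE glue_inH.
rewrite -!(linear_add inH_linear) addrACA addrA -addrA.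
split=> [/inH_inj|] E.
  by rewrite /commutator /= E addrK.
by congr inH; rewrite -E /commutator /= subrK.
Qed.

(** Again the last argument contributes the second half of the commutator, here [beta x h (tau k)];
    the [ad] term is the bracket of [gamma x] with [h] and [k] inside H. *)
Lemma leibniz_MHH x h k :
  delta (brA (inM x) (inH h) (inH k))
    = leibniz brA delta (inM x) (inH h) (inH k) <->
  commutator tau (beta x h) k =
    beta (sigma x) h k + beta x (tau h) k + ad brH (gamma x) h k.
Proof.
rewrite /leibniz !glue_inM !glue_inH !extensionD !extensionE glue_inH.
rewrite -!(linear_add inH_linear) (addrAC (beta (sigma x) h k)).
split=> [/inH_inj|] E.
  by rewrite /commutator /= E addrK.
by congr inH; rewrite -E /commutator /= subrK.
Qed.

Lemma leibniz_HHH h k l :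
  delta (brA (inH h) (inH k) (inH l))
    = leibniz brA delta (inH h) (inH k) (inH l).
Proof.
rewrite /leibniz !glue_inH !extensionE glue_inH.
by rewrite -!(linear_add inH_linear) der_tau.2.
Qed.

Lemma glue_derivation :
  derivation brA delta <-> compatible brM brH mu rho beta sigma tau gamma.
Proof.
split=> [[_ d_delta] | [c_mu c_rho c_beta]].
  split=> [x1 x2 x3 | x1 x2 h | x h k].
  - by apply/leibniz_MMM/d_delta.
  - by apply/leibniz_MMH/d_delta.
  - by apply/leibniz_MHH/d_delta.
split; first exact: glue_linear.
have lin_d := glue_linear.
apply: eq_trilinear_skew3.
- exact: comp_trilinear.
- exact: comp_skew3.
- exact: leibniz_trilinear.
- exact: leibniz_skew3.
- by move=> x y z; apply/leibniz_MMM/c_mu.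
- by move=> x y h; apply/leibniz_MMH/c_rho.
- by move=> x h k; apply/leibniz_MHH/c_beta.
- exact: leibniz_HHH.
Qed.

Lemma glue_extends_to : compatible brM brH mu rho beta sigma tau gamma ->
  extends_to sigma tau brA delta.
Proof.
move=> compat; split; first exact/glue_derivation.
  by move=> h; apply: glue_inH.
by move=> a; rewrite /= /prM /glue /= !addr0.
Qed.

End Extension.

(** * Recovering [gamma] from a given extension *)

Section Decomposition.
Variables (F : fieldType) (M H : lmodType F).
Variables (sigma : M -> M) (tau : H -> H) (delta : M * H -> M * H).
Hypothesis lin_delta : linear delta.

Definition gluing_map (x : M) : H := (delta (inM H x)).2.

Lemma gluing_map_linear : linear gluing_map.
Proof.
move=> c x y; rewrite /gluing_map; have -> : inM H (c *: x + y) = c *: inM H x + inM H y.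
  by congr (_, _); rewrite /= scaler0 addr0.
by rewrite lin_delta.
Qed.

Lemma glue_gluing_map : delta \o @inH F M H =1 @inH F M H \o tau ->
  @prM F M H \o delta =1 sigma \o @prM F M H ->
  delta =1 glue sigma tau gluing_map.
Proof.
move=> dH dM a; rewrite {1}(inM_inH_split a) (linear_add lin_delta).
rewrite (dH a.2 : delta _ = _) /glue; congr (_ + _).
(* The H-components agree by the choice of [gluing_map]; the M-component is [sigma] since [delta]
   commutes with the projection. *)
by rewrite pairE [LHS]surjective_pairing; congr (_, _); apply: (dM (inM H a.1)).
Qed.

End Decomposition.

(** * The criterion for extendability *)

Theorem theorem4p3 (F : fieldType) (char_neq2 : 2%N \notin [pchar F])
    (M H : lmodType F)
    (brM : M -> M -> M -> M) (brH : H -> H -> H -> H)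
    (lieM : three_lie brM) (lieH : three_lie brH)
    (mu : M -> M -> M -> H) (rho : M -> M -> H -> H) (beta : M -> H -> H -> H)
    (data : extension_data brH mu rho beta)
    (brA : M * H -> M * H -> M * H -> M * H)
    (extA : extension_bracket brM brH mu rho beta brA)
    (lieA : three_lie brA)
    (sigma : M -> M) (tau : H -> H)
    (der_sigma : derivation brM sigma) (der_tau : derivation brH tau) :
  [/\ extendable sigma tau brA <->
        exists gamma : {linear M -> H},
          compatible brM brH mu rho beta sigma tau gamma,
      forall gamma : {linear M -> H},
        compatible brM brH mu rho beta sigma tau gamma ->
        extends_to sigma tau brA (glue sigma tau gamma)
    & forall delta : M * H -> M * H,
        extends_to sigma tau brA delta ->
        exists2 gamma : {linear M -> H},
          compatible brM brH mu rho beta sigma tau gamma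
          & delta =1 glue sigma tau gamma].
Proof.
have extendsP delta : extends_to sigma tau brA delta ->
    exists2 gamma : {linear M -> H},
      compatible brM brH mu rho beta sigma tau gamma
      & delta =1 glue sigma tau gamma.
  case=> der_delta dH dM; have [lin_delta _] := der_delta.
  have lin_gamma := gluing_map_linear lin_delta.
  have deltaE := glue_gluing_map lin_delta dH dM.
  (* The witness is bundled as a linear map, as the existential quantifier ranges over
     [{linear M -> H}]. *)
  pose gammaL := GRing.isLinear.Build F M H _ (gluing_map delta) lin_gamma.
  pose gamma : {linear M -> H} := HB.pack (gluing_map delta) gammaL.
  exists gamma => //; apply/(glue_derivation extA) => //.
  exact: eq_derivation der_delta.
have glueP (gamma : {linear M -> H}) :
    compatible brM brH mu rho beta sigma tau gamma ->
    extends_to sigma tau brA (glue sigma tau gamma).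
  by apply: (glue_extends_to extA) => //; apply: linearP.
split=> //; split=> [[delta /extendsP[gamma compat _]] | [gamma /glueP]].
  by exists gamma.
by exists (glue sigma tau gamma).
Qed.
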